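(* Assume the problem is scalar and linear, i.e. $N=1$ and the velocity is $(\xi;t)\mapsto \mathsf a\,\xi$ with $\mathsf a\in\mathbb R$ (so that the fine propagator is $\mathcal F(\xi;t^i,t^j)=(\bar{\mathsf a}_{\mathcal F})^{j-i}\xi$ with $\bar{\mathsf a}_{\mathcal F}\in\mathbb R$), and that the same local time-evolution basis $\boldsymbol\Xi\in\mathbb R^{\bar m\times a}$ is employed for every coarse time interval. Then the local-forecast coarse propagator is linear and satisfies $$\mathcal G_{\mathrm{LF}}(\xi;T^n,T^{n+1})=\bar{\mathsf a}_{\mathrm{LF}}\,\xi,\qquad\bar{\mathsf a}_{\mathrm{LF}}:=1+\sum_{i=1}^\alpha\gamma_i\left[(\bar{\mathsf a}_{\mathcal F})^i-1\right].$$ Further, the parareal recurrence executed with coarse propagator $\mathcal G=\mathcal G_{\mathrm{LF}}$ satisfies, for every $k\ge0$, $$\max_{1\le n\le M}|x(T^n)-x_k^n|\le\rho^k\,\|(\mathbf M(\bar{\mathsf a}_{\mathrm{LF}}))^k\|_\infty\max_{1\le n\le M}|x(T^n)-x_0^n|,$$ where $\rho:=|(\bar{\mathsf a}_{\mathcal F})^{\bar m}-\bar{\mathsf a}_{\mathrm{LF}}|=\big|(\bar{\mathsf a}_{\mathcal F})^{\bar m}-1-\sum_{i=1}^\alpha\gamma_i[(\bar{\mathsf a}_{\mathcal F})^i-1]\big|$. If additionally $\big|1+\sum_{i=1}^\alpha\gamma_i[(\bar{\mathsf a}_{\mathcal F})^i-1]\big|<1$, then the recurrence converges superlinearly as $$\max_{1\le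 n\le M}|x(T^n)-x_k^n|\le\frac{\rho^k\prod_{j=1}^k(M-j)}{k!}\max_{1\le n\le M}|x(T^n)-x_0^n|.$$
   Context: Let $M,\bar m$ be positive integers, $m=\bar m M$, $0<T_{\mathrm{final}}<\infty$, $h=T_{\mathrm{final}}/m$, $H=\bar m h$; fine time instances $t^i=ih$ ($0\le i\le m$), coarse time instances $T^n=nH=t^{\bar m n}$ ($0\le n\le M$). The scalar ODE is $\frac{d}{dt}x^\star=\mathsf a x^\star$, $x^\star(0)=x^0\in\mathbb R$. The numerical solution is $x(t^i)=\mathcal F(x^0;0,t^i)$. The memory $\alpha$ and basis dimension $a$ are positive integers with $a\le\alpha\le\bar m$. $\boldsymbol\Xi\in\mathbb R^{\bar m\times a}$ has orthonormal columns; $\mathbf Z_0\in\{0,1\}^{\alpha\times\bar m}$ extracts the first $\alpha$ entries of a vector in $\mathbb R^{\bar m}$; $^+$ is the Moore--Penrose pseudoinverse; $\gamma_i:=\mathbf e_{\bar m}^T\boldsymbol\Xi[\mathbf Z_0\boldsymbol\Xi]^+\mathbf e_i\in\mathbb R$, $1\le i\le\alpha$. In this scalar setting the restriction and prolongation operators equal $1$ and the local-forecast coarse propagator is $$\mathcal G_{\mathrm{LF}}(\xi;T^n,T^{n+1})=\xi+\sum_{i=1}^\alpha\gamma_i\left[\mathcal F(\xi;T^n,t^{\bar m n+i})-\xi\right],\qquad \xi\in\mathbb R,\ 0\le n\le M-1.$$ Parareal recurrence: given an initial guess $x_0^0=x^0,x_0^1,\dots,x_0^M$, for $k=0,1,\dots$,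 $$x_{k+1}^{n+1}=\mathcal G(x_{k+1}^n;T^n,T^{n+1})+\mathcal F(x_k^n;T^n,T^{n+1})-\mathcal G(x_k^n;T^n,T^{n+1}),\qquad n=k,\dots,M-1,$$ and $x_{k+1}^n=x_k^n$ for $n\le k$. For $\beta\in\mathbb R$, $\mathbf M(\beta)\in\mathbb R^{M\times M}$ is the (strictly lower triangular) Toeplitz matrix with first column entries $0$ in row $1$ and $\beta^{i-2}$ in row $i\in\{2,\dots,M\}$; $\|\cdot\|_\infty$ is the induced matrix infinity norm. *)

(* Defs.v *)
From mathcomp Require Import all_boot all_order all_algebra.
From mathcomp Require Import all_classical all_reals all_analysis.

Set Implicit Arguments.
Unset Strict Implicit.
Unset Printing Implicit Defensive.

Import Order.TTheory GRing.Theory Num.Theory.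
Import numFieldNormedType.Exports.

Local Open Scope classical_set_scope.
Local Open Scope ring_scope.

(** * Moore-Penrose pseudoinverse (real case, via the four Penrose conditions) *)

Definition penrose (R : realType) (m n : nat)
    (A : 'M[R]_(m, n)) (X : 'M[R]_(n, m)) : Prop :=
  [/\ A *m X *m A = A, X *m A *m X = X,
      (A *m X)^T = A *m X & (X *m A)^T = X *m A].

Definition pseudoinv (R : realType) (m n : nat) (A : 'M[R]_(m, n)) :
    'M[R]_(n, m) :=
  xget 0 [set X | penrose A X].

Lemma gram_unit (R : realType) (r m : nat) (A : 'M[R]_(r, m)) :
  row_free A -> A *m A^T \in unitmx.
Proof.
move=> fA; rewrite -row_free_unit; apply/inj_row_free => v vAA.
suff vA0 : v *m A = 0 by apply: (row_free_inj fA); rewrite vA0 mul0mx.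
have : (v *m A) *m (v *m A)^T = 0.
  by rewrite trmx_mul mulmxA -(mulmxA v) vAA mul0mx.
move: (v *m A) => w /matrixP/(_ 0 0)/eqP; rewrite !mxE psumr_eq0; last first.
  by move=> k _; rewrite mxE -expr2 sqr_ge0.
move=> /allP w0; apply/rowP => j; have := w0 j (mem_index_enum j).
by rewrite !mxE mulf_eq0 orbb => /eqP.
Qed.

Lemma penrose_ex (R : realType) (m n : nat) (A : 'M[R]_(m, n)) :
  exists X, penrose A X.
Proof.
have [r [C [B [CBA fB fC]]]] : exists r (C : 'M[R]_(m, r)) (B : 'M[R]_(r, n)),
    [/\ C *m B = A, row_free B & row_full C].
  exists (\rank A), (col_base A), (row_base A).
  by rewrite mulmx_base row_base_free col_base_full.
have uB : B *m B^T \in unitmx by exact: gram_unit.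
have uC : C^T *m C \in unitmx.
  by rewrite -{2}[C]trmxK; apply: gram_unit; rewrite /row_free mxrank_tr.
have sB : (invmx (B *m B^T))^T = invmx (B *m B^T).
  by rewrite trmx_inv trmx_mul trmxK.
have sC : (invmx (C^T *m C))^T = invmx (C^T *m C).
  by rewrite trmx_inv trmx_mul trmxK.
pose P := B^T *m invmx (B *m B^T); pose Q := invmx (C^T *m C) *m C^T.
have BP : B *m P = 1%:M by rewrite mulmxA mulmxV.
have QC : Q *m C = 1%:M by rewrite -mulmxA mulVmx.
have AX : A *m (P *m Q) = C *m Q.
  by rewrite -CBA -mulmxA (mulmxA B) BP mul1mx.
have XA : P *m Q *m A = P *m B.
  by rewrite -CBA -mulmxA (mulmxA Q) QC mul1mx.
exists (P *m Q); split.
- by rewrite AX -CBA -mulmxA (mulmxA Q) QC mul1mx.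
- by rewrite XA -mulmxA (mulmxA B) BP mul1mx.
- by rewrite AX /Q !trmx_mul sC trmxK mulmxA.
- by rewrite XA /P !trmx_mul sB trmxK mulmxA.
Qed.

Lemma penrose_uniq (R : realType) (m n : nat) (A : 'M[R]_(m, n))
    (X Y : 'M[R]_(n, m)) : penrose A X -> penrose A Y -> X = Y.
Proof.
move=> [x1 x2 x3 x4] [y1 y2 y3 y4].
have AXY : A *m X = A *m Y.
  rewrite -{1}y1 -(mulmxA (A *m Y)) -y3 -x3 -trmx_mul.
  by rewrite mulmxA x1 y3.
have XAY : X *m A = Y *m A.
  rewrite -{1}y1 -(mulmxA A) mulmxA -x4 -y4 -trmx_mul.
  by rewrite -mulmxA (mulmxA A) x1 y4.
by rewrite -x2 -mulmxA AXY mulmxA XAY.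
Qed.

Lemma pseudoinvP (R : realType) (m n : nat) (A : 'M[R]_(m, n)) :
  penrose A (pseudoinv A).
Proof. exact: (xgetPex 0 (penrose_ex A)). Qed.

(** * Local-forecast coarse propagator *)

(* Canonical basis vector of R^n, with the index [i] counted from 1. *)
Definition evec (R : realType) (n i : nat) : 'cV[R]_n :=
  \col_(j < n) (j.+1 == i)%:R.

(* Sampling matrix: keeps the first [alpha] entries of a vector of R^mbar. *)
Definition sampling (R : realType) (alpha mbar : nat) : 'M[R]_(alpha, mbar) :=
  \matrix_(i < alpha, j < mbar) (i == j :> nat)%:R.

(* Meaningful for 1 <= i <= alpha. *)
Definition gamma (R : realType) (mbar adim alpha : nat)
    (Xi : 'M[R]_(mbar, adim)) (i : nat) : R :=
  ((evec R mbar mbar)^T *m Xi *m pseudoinv (sampling R alpha mbar *m Xi)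
     *m evec R alpha i) 0 0.

Definition timestep (R : realType) (Tfinal : R) (M mbar : nat) : R :=
  Tfinal / (mbar * M)%:R.

Definition fine_time (R : realType) (Tfinal : R) (M mbar i : nat) : R :=
  i%:R * timestep Tfinal M mbar.

Definition coarse_time (R : realType) (Tfinal : R) (M mbar n : nat) : R :=
  n%:R * (mbar%:R * timestep Tfinal M mbar).

(* [F xi s t] propagates the state [xi] from time [s] to time [t]; the coarse
   propagator [G n xi] propagates [xi] from T^n to T^(n+1). *)
Definition G_LF (R : realType) (Tfinal : R) (M mbar adim alpha : nat)
    (Xi : 'M[R]_(mbar, adim)) (F : R -> R -> R -> R) (n : nat) (xi : R) : R :=
  xi + \sum_(1 <= i < alpha.+1)
         gamma alpha Xi i *
         (F xi (coarse_time Tfinal M mbar n)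
               (fine_time Tfinal M mbar (mbar * n + i)) - xi).

(** * Parareal *)

(* [x k n] is the iterate x_k^n; the initial guess [x 0 n], 1 <= n <= M, is
   arbitrary. *)
Definition parareal (R : realType) (Tfinal : R) (M mbar : nat)
    (G : nat -> R -> R) (F : R -> R -> R -> R) (x0 : R)
    (x : nat -> nat -> R) : Prop :=
  let T := coarse_time Tfinal M mbar in
  [/\ x 0%N 0%N = x0,
      forall k n, (k <= n < M)%N ->
        x k.+1 n.+1 = G n (x k.+1 n) + F (x k n) (T n) (T n.+1) - G n (x k n)
    & forall k n, (n <= k)%N -> (n <= M)%N -> x k.+1 n = x k n].

(** * Matrices and norms *)

(* Strictly lower triangular Toeplitz matrix whose first column is
   (0, 1, beta, beta^2, ...). *)
Definition Mtoep (R : realType) (M : nat) (beta : R) : 'M[R]_M :=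
  \matrix_(i < M, j < M) if (j < i)%N then beta ^+ (i - j).-1 else 0.

(* The norm of a column vector is the maximum of the absolute values of its
   entries ([mx_norm]), so this is the induced infinity norm. *)
Definition inorm (R : realType) (n : nat) (A : 'M[R]_n) : R :=
  sup [set `|A *m v| / `|v| | v in [set v : 'cV[R]_n | v != 0]].

(* Main.v *)
(* With e k n := x(T^n) - x_k^n and d := aF^mbar - aLF, linearity of F and of
   G_LF turns the parareal update into e (k+1) (n+1) = aLF e (k+1) n + d e k n,
   and iterate k is exact at the first k coarse instances, so the recurrence
   holds for every n < M.  Unrolling it in n gives
   e (k+1) (n+1) = d sum_(j < n) aLF^(n-1-j) e k (j+1), which is d times the
   Toeplitz matrix applied to the error vector.  When |aLF| <= 1 the same
   formula and sum_(j < n) 'C(j, k) = 'C(n, k+1) yield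
   |e k (n+1)| <= |d|^k 'C(n, k) max |e 0|, and 'C(M-1, k) is the stated
   product divided by k!. *)
Require Import Defs.
From mathcomp Require Import all_boot all_order all_algebra.
From mathcomp Require Import all_classical all_reals all_analysis.
From mathcomp Require Import ring.

Import Order.TTheory GRing.Theory Num.Theory.
Import numFieldNormedType.Exports.

Local Open Scope ring_scope.

Lemma normr_cV_le (R : realType) (n : nat) (v : 'cV[R]_n) (c : R) :
  0 <= c -> (forall i, `|v i 0| <= c) -> `|v| <= c.
Proof.
move=> c0 vc; rewrite [leLHS]/Num.Def.normr /= mx_normrE.
by apply: bigmax_le => // -[i j] _ /=; rewrite (ord1 j).
Qed.

Lemma normr_cV_ge (R : realType) (n : nat) (v : 'cV[R]_n) (i : 'I_n) :
  `|v i 0| <= `|v|.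
Proof.
rewrite [leRHS]/Num.Def.normr /= mx_normrE.
exact: (le_bigmax_cond 0 (j := (i, 0)) (fun ij => `|v ij.1 ij.2|)).
Qed.

(** Turns the maximum over the instances 1 to [n], the form in which [err] is given, into the norm
    of a column whose rows count from 0. *)
Lemma normr_cV_bigmax (R : realType) (n : nat) (f : nat -> R) :
  `|\col_(i < n) f i.+1| = \big[Num.max/0]_(1 <= i < n.+1) `|f i|.
Proof.
apply/eqP; rewrite eq_le; apply/andP; split.
  apply: normr_cV_le => [|i]; first exact: bigmax_ge_id.
  rewrite mxE; apply: (le_bigmax_seq 0 i.+1 _ (fun i => `|f i|)) => //.
  by rewrite mem_index_iota /= ltnS ltn_ord.
rewrite big_seq; apply: bigmax_le => // -[|i]; rewrite mem_index_iota //=.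
rewrite ltnS => ilt.
have := normr_cV_ge R n (\col_(i < n) f i.+1) (Ordinal ilt).
by rewrite mxE.
Qed.

Lemma inorm_ge (R : realType) (n : nat) (A : 'M[R]_n) (v : 'cV[R]_n) :
  `|A *m v| <= inorm A * `|v|.
Proof.
have [->|v0] := eqVneq v 0; first by rewrite mulmx0 !normr0 mulr0.
rewrite -ler_pdivrMr ?normr_gt0 //; apply: ub_le_sup; last by exists v.
(* [sup] dominates its set only once the quotients are known to be bounded; the sum of all absolute
   entries exceeds every row sum. *)
exists (\sum_i \sum_j `|A i j|) => _ [w /= w0 <-].
rewrite ler_pdivrMr ?normr_gt0 //.
apply: normr_cV_le => [|i].
  by rewrite mulr_ge0 ?sumr_ge0 // => i _; rewrite sumr_ge0.
rewrite mxE (le_trans (ler_norm_sum _ _ _)) //.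
apply: (@le_trans _ _ (\sum_j `|A i j| * `|w|)).
  by apply: ler_sum => j _; rewrite normrM ler_wpM2l // normr_cV_ge.
rewrite -mulr_suml ler_wpM2r // [leRHS](bigD1 i) //= lerDl sumr_ge0 // => l _.
by rewrite sumr_ge0.
Qed.

(** Hockey-stick identity, by Pascal's rule. *)
Lemma sum_bin_col (m k : nat) : (\sum_(0 <= j < m) 'C(j, k))%N = 'C(m, k.+1).
Proof.
elim: m => [|m IHm]; first by rewrite big_geq // bin0n.
by rewrite big_nat_recr //= IHm binS.
Qed.

(** The product is the falling factorial of [M.-1]. Beyond [j = M] its factors in [R] are negative
    whereas subtraction in [nat] truncates, hence the case split. *)
Lemma prod_subn_bin (R : numFieldType) (M k : nat) : (0 < M)%N ->
  \prod_(1 <= j < k.+1) (M%:R - j%:R) / (k`!)%:R = 'C(M.-1, k)%:R :> R.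
Proof.
case: M => // M _ /=.
have k0 : (k`!)%:R != 0 :> R by rewrite pnatr_eq0 -lt0n fact_gt0.
apply: (canLR (mulfK k0)); rewrite -natrM bin_ffact ffact_prod.
rewrite big_add1 /= big_mkord.
have [kM|Mk] := leqP k M.
  rewrite natr_prod; apply: eq_bigr => i _.
  have iM : (i <= M)%N by rewrite (leq_trans (ltnW (ltn_ord i))).
  by rewrite -natrB ?ltnS // subSS.
(* both products contain the zero factor at index [M] *)
rewrite (bigD1 (Ordinal Mk)) //= subrr mul0r.
by rewrite [X in X%:R](bigD1 (Ordinal Mk)) //= subnn mul0n.
Qed.

(** Discrete variation of constants: the zero value at instance 0 kills both the homogeneous part
    and the first source term, so only instances from 1 on enter the sum. *)
Lemma unroll_error (R : comPzRingType) (M : nat) (beta d : R)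
    (e : nat -> nat -> R) :
  (forall k, e k 0%N = 0) ->
  (forall k n, (n < M)%N -> e k.+1 n.+1 = beta * e k.+1 n + d * e k n) ->
  forall k n, (n < M)%N ->
    e k.+1 n.+1 = d * \sum_(0 <= j < n) beta ^+ (n - j).-1 * e k j.+1.
Proof.
move=> e0 erec k; elim=> [|n IHn] nM.
  by rewrite erec // !e0 big_geq // !mulr0 addr0.
rewrite erec // IHn ?(ltnW nM) // big_nat_recr //= subSnn expr0 mul1r.
rewrite mulrDr mulrCA mulr_sumr; congr (d * _ + _).
apply: eq_big_nat => j /andP[_ jn].
by rewrite mulrA -exprS subSn ?(ltnW jn) //= prednK // subn_gt0.
Qed.

Lemma error_mx (R : realType) (M : nat) (beta d : R) (e : nat -> nat -> R) :
  (forall k, e k 0%N = 0) ->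
  (forall k n, (n < M)%N -> e k.+1 n.+1 = beta * e k.+1 n + d * e k n) ->
  forall k, \col_(i < M) e k i.+1
            = d ^+ k *: (Mtoep M beta ^+ k *m \col_(i < M) e 0%N i.+1).
Proof.
move=> e0 erec; elim=> [|k IHk]; first by rewrite !expr0 scale1r mul1mx.
rewrite !exprS -[Mtoep M beta * _]/(Mtoep M beta *m _) -mulmxA -scalerA.
rewrite scalemxAr -IHk; apply/colP => i.
rewrite !mxE (unroll_error R M beta d) //; congr (d * _).
(* The sum over [j < i] is padded with the zero entries of [Mtoep] on and above the diagonal. *)
rewrite (big_nat_widen _ _ M) ?(ltnW (ltn_ord i)) // big_mkord big_mkcond /=.
apply: eq_bigr => j _; rewrite !mxE.
by case: ifP; rewrite ?mul0r.
Qed.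

(** Bounding the powers of [beta] by 1 leaves the sum of ['C(j, k)] over [j < n], which is
    ['C(n, k.+1)]. The induction on [k] uses the bound at each [n], not only its maximum. *)
Lemma error_bin (R : numDomainType) (M : nat) (beta d c : R)
    (e : nat -> nat -> R) :
  `|beta| <= 1 -> 0 <= c ->
  (forall k, e k 0%N = 0) ->
  (forall k n, (n < M)%N -> e k.+1 n.+1 = beta * e k.+1 n + d * e k n) ->
  (forall n, (n < M)%N -> `|e 0%N n.+1| <= c) ->
  forall k n, (n < M)%N -> `|e k n.+1| <= `|d| ^+ k * 'C(n, k)%:R * c.
Proof.
move=> beta1 c0 e0 erec ec; elim=> [|k IHk] n nM.
  by rewrite expr0 bin0 !mul1r ec.
rewrite (unroll_error R M beta d) // normrM exprS -!mulrA ler_wpM2l //.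
rewrite -sum_bin_col natr_sum mulr_suml mulr_sumr.
apply: le_trans (ler_norm_sum _ _ _) _; apply: ler_sum_nat => j /andP[_ jn].
rewrite normrM normrX mulrA -[leRHS]mul1r.
by rewrite ler_pM ?exprn_ge0 ?exprn_ile1 // IHk // (ltn_trans jn).
Qed.

Theorem corollary4p13 (R : realType) (Tfinal : R) (M mbar adim alpha : nat)
  (hT : 0 < Tfinal) (hM : (0 < M)%N) (hmbar : (0 < mbar)%N)
  (hadim : (0 < adim)%N) (hadim_alpha : (adim <= alpha)%N)
  (halpha_mbar : (alpha <= mbar)%N)
  (Xi : 'M[R]_(mbar, adim)) (hXi : Xi^T *m Xi = 1%:M)
  (Fprop : (R -> R -> R) -> R -> R -> R -> R) (av aF x0 : R)
  (hF : forall (xi : R) (i j : nat), (i <= j <= mbar * M)%N ->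
    Fprop (fun y _ => av * y) xi
          (fine_time Tfinal M mbar i) (fine_time Tfinal M mbar j)
    = aF ^+ (j - i) * xi) :
  let F := Fprop (fun y _ => av * y) in
  let G := G_LF Tfinal M alpha Xi F in
  let aLF := 1 + \sum_(1 <= i < alpha.+1) gamma alpha Xi i * (aF ^+ i - 1) in
  let rho := `|aF ^+ mbar - aLF| in
  let err (y : nat -> R) := \big[Num.max/0]_(1 <= n < M.+1)
        `|F x0 0 (coarse_time Tfinal M mbar n) - y n| in
  [/\ forall n : nat, (n < M)%N ->
        linear (G n : R^o -> R^o) /\ (forall xi : R, G n xi = aLF * xi),
      rho = `|aF ^+ mbar - 1
              - \sum_(1 <= i < alpha.+1) gamma alpha Xi i * (aF ^+ i - 1)|
    & forall x : nat -> nat -> R, parareal Tfinal M mbar G F x0 x ->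
        (forall k : nat,
           err (x k) <= rho ^+ k * inorm (Mtoep M aLF ^+ k) * err (x 0%N))
        /\ (`|aLF| < 1 -> forall k : nat,
           err (x k) <= rho ^+ k * (\prod_(1 <= j < k.+1) (M%:R - j%:R))
                        / (k`!)%:R * err (x 0%N))].
Proof.
move=> F G aLF rho err.
have fineE i j xi : (i <= j <= mbar * M)%N ->
    F xi (fine_time Tfinal M mbar i) (fine_time Tfinal M mbar j)
    = aF ^+ (j - i) * xi by exact: hF.
(* The action of [F] is given between fine grid instants, so coarse times and the initial time 0 are
   rewritten as fine times. *)
have coarseE n :
    coarse_time Tfinal M mbar n = fine_time Tfinal M mbar (mbar * n).
  by rewrite /coarse_time /fine_time natrM mulrA [_ * mbar%:R]mulrC.
have time0 : 0 = fine_time Tfinal M mbar 0 by rewrite /fine_time mul0r.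
have GE n xi : (n < M)%N -> G n xi = aLF * xi.
  move=> nM; rewrite /G /G_LF /aLF mulrDl mul1r mulr_suml; congr (_ + _).
  apply: eq_big_nat => i /andP[_ ia]; rewrite coarseE fineE.
    by rewrite addKn -mulrA mulrBl mul1r.
  (* The index [mbar * n + i] stays on the grid: [i <= alpha <= mbar] and [n < M]. *)
  rewrite leq_addr /=; apply: (@leq_trans (mbar * n.+1)).
    by rewrite mulnS addnC leq_add2r (leq_trans _ halpha_mbar).
  by rewrite leq_mul2l nM orbT.
split.
- move=> n nM; split; last by move=> xi; exact: GE.
  by move=> c u v; rewrite !GE // mulrDr; congr (_ + _); rewrite mulrCA.
- by rewrite /rho /aLF opprD addrA.
move=> x [x00 xrec xlow].
pose e k n := F x0 0 (coarse_time Tfinal M mbar n) - x k n.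
have exactE n : (n <= M)%N ->
    F x0 0 (coarse_time Tfinal M mbar n) = aF ^+ (mbar * n) * x0.
  by move=> nM; rewrite coarseE time0 fineE ?subn0 // leq_mul2l nM orbT.
have erec0 k n : (k <= n < M)%N ->
    e k.+1 n.+1 = aLF * e k.+1 n + (aF ^+ mbar - aLF) * e k n.
  move=> /[dup] knM /andP[kn nM]; rewrite /e xrec // !exactE ?(ltnW nM) //.
  rewrite !GE // !coarseE fineE; last by rewrite !leq_mul2l leqnSn nM !orbT.
  by rewrite -mulnBr subSnn muln1 mulnS exprD; ring.
(* Finite exactness: instance [k.+1] is updated from instance [k], already exact, and earlier
   instances are frozen. *)
have elow k n : (n <= k)%N -> (n <= M)%N -> e k n = 0.
  elim: k n => [|k IHk] n.
    rewrite leqn0 => /eqP-> _.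
    by rewrite /e exactE // muln0 expr0 mul1r x00 subrr.
  rewrite leq_eqVlt ltnS => /orP[/eqP-> kM|nk nM].
    rewrite erec0 ?leqnn // /e xlow ?(ltnW kM) // -/(e k k).
    by rewrite IHk ?(ltnW kM) // !mulr0 addr0.
  by rewrite /e xlow // -/(e k n) IHk.
have e0 k : e k 0%N = 0 by apply: elow.
(* For [n < k] all three errors vanish, which extends the update to every [n < M]. *)
have erec k n : (n < M)%N ->
    e k.+1 n.+1 = aLF * e k.+1 n + (aF ^+ mbar - aLF) * e k n.
  move=> nM; have [kn|nk] := leqP k n; first by rewrite erec0 ?kn.
  rewrite !elow ?(ltnW nM) ?ltnS ?(leqW (ltnW nk)) // ?(ltnW nk) //.
  by rewrite !mulr0 addr0.
have errE k : err (x k) = `|\col_(i < M) e k i.+1| by rewrite normr_cV_bigmax.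
split=> [k|aLF1 k].
  rewrite !errE (error_mx R M aLF (aF ^+ mbar - aLF)) // normrZ normrX -mulrA.
  by rewrite ler_wpM2l ?exprn_ge0 // inorm_ge.
rewrite -[X in X * _]mulrA prod_subn_bin // [leLHS]errE.
have err0 : 0 <= err (x 0%N) by exact: bigmax_ge_id.
have rhok : 0 <= rho ^+ k by rewrite exprn_ge0 ?normr_ge0.
apply: normr_cV_le => [|i]; first by rewrite !mulr_ge0.
have ec n : (n < M)%N -> `|e 0%N n.+1| <= err (x 0%N).
  move=> nM; have := normr_cV_ge R M (\col_(i < M) e 0%N i.+1) (Ordinal nM).
  by rewrite errE mxE.
have ebin := error_bin R M aLF _ _ e (ltW aLF1) err0 e0 erec ec k i.
rewrite mxE; apply: le_trans (ebin (ltn_ord i)) _.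
(* Row [i] carries ['C(i, k)], which is largest in the last row, [i = M.-1]. *)
by rewrite ler_wpM2r // ler_wpM2l // ler_nat leq_bin2l // -ltnS prednK.
Qed.
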